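(* Let $\Lambda\subset\mathbb{R}^2$ and $\Omega\subset\mathbb{R}$ be open, $x=(x^1,x^2)$, and let $$\mathcal{P}(2)=\sum_{k=0}^{2}\sum_{h=1}^{2^k}g_{k,h}(x,\cdot)\,\mathrm{D}_{k,h},\qquad g_{k,h}\in\mathcal{C}(\Lambda\times\Omega,\mathbb{R}).$$ A necessary and sufficient condition for $\mathcal{P}(2)$ to be decomposed into the form $$\mathcal{P}(2)=\big[b_{1,0,1}(x,\cdot)\mathrm{D}_{0,1}+b_{1,1,1}(x,\cdot)\mathrm{D}_{1,1}+b_{1,1,2}(x,\cdot)\mathrm{D}_{1,2}\big]\big[b_{2,0,1}(x,\cdot)\mathrm{D}_{0,1}+b_{2,1,1}(x,\cdot)\mathrm{D}_{1,1}+b_{2,1,2}(x,\cdot)\mathrm{D}_{1,2}\big],$$ with $b_{1,k,h}\in\mathcal{C}(\Lambda\times\Omega,\mathbb{R})$ and $b_{2,k,h}\in\mathcal{C}^1(\Lambda\times\Omega,\mathbb{R})$, is that these functions satisfy, at every $(x,u)\in\Lambda\times\Omega$, \begin{align*} g_{2,1}&=b_{1,1,1}b_{2,1,1},\\ g_{2,2}+g_{2,3}&=b_{1,1,2}b_{2,1,1}+b_{1,1,1}b_{2,1,2},\\ g_{2,4}&=b_{1,1,2}b_{2,1,2},\\ g_{1,1}&=b_{1,0,1}b_{2,1,1}+b_{1,1,1}b_{2,0,1}+\mathcal{L}(b_{2,1,1})+b_{1,1,1}\mathrm{D}_{1,3}(b_{2,0,1})\,u,\\ g_{1,2}&=b_{1,0,1}b_{2,1,2}+b_{1,1,2}b_{2,0,1}+\mathcal{L}(b_{2,1,2})+b_{1,1,2}\mathrm{D}_{1,3}(b_{2,0,1})\,u,\\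 g_{0,1}&=b_{1,0,1}b_{2,0,1}+\mathcal{L}(b_{2,0,1}),\\ 0&=b_{1,1,2}\mathrm{D}_{1,3}(b_{2,1,2}),\\ 0&=b_{1,1,1}\mathrm{D}_{1,3}(b_{2,1,1}),\\ 0&=b_{1,1,1}\mathrm{D}_{1,3}(b_{2,1,2})+b_{1,1,2}\mathrm{D}_{1,3}(b_{2,1,1}), \end{align*} where $\mathcal{L}=b_{1,1,1}\mathrm{D}_{1,1}+b_{1,1,2}\mathrm{D}_{1,2}$.
   Context: For a function $u=u(x^1,x^2)$: $\mathrm{D}_{0,1}u=u$, $\mathrm{D}_{1,1}u=u_{x^1}$, $\mathrm{D}_{1,2}u=u_{x^2}$, $\mathrm{D}_{2,1}u=\frac{\partial^2u}{(\partial x^1)^2}$, $\mathrm{D}_{2,2}u=\frac{\partial}{\partial x^2}\frac{\partial u}{\partial x^1}$, $\mathrm{D}_{2,3}u=\frac{\partial}{\partial x^1}\frac{\partial u}{\partial x^2}$, $\mathrm{D}_{2,4}u=\frac{\partial^2u}{(\partial x^2)^2}$. For a function $b(x^1,x^2,u)$ on $\Lambda\times\Omega$, regarded as a function of three independent variables, $\mathrm{D}_{1,1}(b)=\partial b/\partial x^1$, $\mathrm{D}_{1,2}(b)=\partial b/\partial x^2$, $\mathrm{D}_{1,3}(b)=\partial b/\partial u$. The operator $\mathcal{P}(2)$ acts on $u$ by $\mathcal{P}(2)u=\sum_{k,h}g_{k,h}(x,u)\,\mathrm{D}_{k,h}u$. The product of the two brackets acts on $u$ by first forming $w(x)=b_{2,0,1}(x,u(x))u+b_{2,1,1}(x,u(x))u_{x^1}+b_{2,1,2}(x,u(x))u_{x^2}$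 and then $b_{1,0,1}(x,u(x))w+b_{1,1,1}(x,u(x))w_{x^1}+b_{1,1,2}(x,u(x))w_{x^2}$; that is, the coefficients of both factors are evaluated at the original function $u$. Equality of operators means that both sides give the same result on every $u\in\mathcal{C}^2(\Lambda_0,\Omega)$, for open $\Lambda_0\subset\Lambda$. *)

(* Defs.v *)
From Stdlib Require Export Reals.
From Coquelicot Require Export Coquelicot.
Open Scope R_scope.

(** Real functions of [x = (x1, x2)], and functions of the three independent
    variables [(x, s)].  All functions are total; only their values on the
    open set under consideration matter. *)
Definition fun2 := R * R -> R.
Definition fun3 := R * R * R -> R.

Definition Dx1 (u : fun2) : fun2 := fun x => Derive (fun t => u (t, snd x)) (fst x).
Definition Dx2 (u : fun2) : fun2 := fun x => Derive (fun t => u (fst x, t)) (snd x).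

Definition ex_Dx1 (u : fun2) (x : R * R) : Prop :=
  ex_derive (fun t => u (t, snd x)) (fst x).
Definition ex_Dx2 (u : fun2) (x : R * R) : Prop :=
  ex_derive (fun t => u (fst x, t)) (snd x).

(** [Dkh k h] is D_{k,h}, for [k <= 2] and [1 <= h <= 2 ^ k]; the value for
    other indices is a dummy one. *)
Definition Dkh (k h : nat) (u : fun2) : fun2 :=
  match k, h with
  | 0%nat, 1%nat => u
  | 1%nat, 1%nat => Dx1 u
  | 1%nat, 2%nat => Dx2 u
  | 2%nat, 1%nat => Dx1 (Dx1 u)
  | 2%nat, 2%nat => Dx2 (Dx1 u)
  | 2%nat, 3%nat => Dx1 (Dx2 u)
  | 2%nat, 4%nat => Dx2 (Dx2 u)
  | _, _ => fun _ => 0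
  end.

(** D_{1,1}, D_{1,2} and D_{1,3} on functions of [(x, s)]. *)
Definition D3x1 (c : fun3) : fun3 := fun p => Dx1 (fun y => c (y, snd p)) (fst p).
Definition D3x2 (c : fun3) : fun3 := fun p => Dx2 (fun y => c (y, snd p)) (fst p).
Definition D3u (c : fun3) : fun3 := fun p => Derive (fun t => c (fst p, t)) (snd p).

Fixpoint Cn2 (n : nat) (A : R * R -> Prop) (u : fun2) : Prop :=
  continuous_on A u /\
  match n with
  | 0%nat => True
  | S m => (forall x, A x -> ex_Dx1 u x /\ ex_Dx2 u x) /\
           Cn2 m A (Dx1 u) /\ Cn2 m A (Dx2 u)
  end.

Definition C2_into (A : R * R -> Prop) (Omega : R -> Prop) (u : fun2) : Prop :=
  Cn2 2 A u /\ (forall x, A x -> Omega (u x)).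

Definition setprod (Lambda : R * R -> Prop) (Omega : R -> Prop) : R * R * R -> Prop :=
  fun p => Lambda (fst p) /\ Omega (snd p).

Definition C0_3 (A : R * R * R -> Prop) (c : fun3) : Prop := continuous_on A c.

Definition C1_3 (A : R * R * R -> Prop) (c : fun3) : Prop :=
  continuous_on A c /\
  (forall p, A p ->
     ex_Dx1 (fun y => c (y, snd p)) (fst p) /\
     ex_Dx2 (fun y => c (y, snd p)) (fst p) /\
     ex_derive (fun t => c (fst p, t)) (snd p)) /\
  continuous_on A (D3x1 c) /\ continuous_on A (D3x2 c) /\ continuous_on A (D3u c).

Definition index (m k h : nat) : Prop := (k <= m)%nat /\ (1 <= h <= 2 ^ k)%nat.

(** The operator of order [m] with coefficients [c], applied to [v], the
    coefficients being evaluated at [u]. *)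
Definition op (m : nat) (c : nat -> nat -> fun3) (u v : fun2) : fun2 :=
  fun x => sum_n_m (fun k =>
             sum_n_m (fun h => c k h (x, u x) * Dkh k h v x) 1 (2 ^ k)) 0 m.

(** In a product of two brackets acting on [u], the coefficients of both
    factors are evaluated at the original [u]. *)
Definition decomposes (Lambda : R * R -> Prop) (Omega : R -> Prop)
    (g : nat -> nat -> fun3) (b : nat -> nat -> nat -> fun3) : Prop :=
  forall Lambda0 : R * R -> Prop,
    open Lambda0 -> (forall x, Lambda0 x -> Lambda x) ->
    forall u : fun2, C2_into Lambda0 Omega u ->
    forall x, Lambda0 x ->
      op 2 g u u x = op 1 (b 1%nat) u (op 1 (b 2%nat) u u) x.

Definition Lop (b : nat -> nat -> nat -> fun3) (c : fun3) : fun3 :=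
  fun p => b 1%nat 1%nat 1%nat p * D3x1 c p + b 1%nat 1%nat 2%nat p * D3x2 c p.

(* Main.v *)
From Stdlib Require Import Lra Lia FunctionalExtensionality.
Require Import Defs.

(** Carrying out the product of the two brackets on a [C^2] function [u], by
    the chain rule for [t |-> c (x + t e_i, u (x + t e_i))], gives a polynomial
    in the jet [(u, u_1, u_2, u_11, u_12, u_21, u_22)] at the point considered
    ([bracket_product]).  Its linear coefficients are the right-hand sides of
    the first six conditions, except that the order-zero one carries a
    factor [u].  The chain rule also creates terms quadratic in the gradient
    of [u]; their coefficients are the expressions that the last three
    conditions set to zero.

    Sufficiency follows by comparing polynomials, once [u_12 = u_21]
    ([Schwarz_C2]) merges [g_{2,2}] and [g_{2,3}].

    For necessity, a quadratic polynomial centred at [x] realises any 2-jet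
    with [u_12 = u_21] there, so both sides agree as polynomials in the
    jet; finitely many jets suffice to read off the coefficients.  The order-zero
    coefficient comes out as [g_{0,1} s = (...) s], where [s] is the value of [u];
    this says nothing at [s = 0], and continuity of the coefficients closes
    that gap ([continuous_cancel_id]). *)

(** * Open sets and continuity *)

Lemma open_setprod (Lambda : R * R -> Prop) (Omega : R -> Prop) :
  open Lambda -> open Omega -> open (setprod Lambda Omega).
Proof.
  intros hL hO; apply open_and.
  - apply (open_comp (fun p : R * R * R => fst p) Lambda); [|exact hL].
    intros [x s] _; apply continuous_fst.
  - apply (open_comp (fun p : R * R * R => snd p) Omega); [|exact hO].
    intros [x s] _; apply continuous_snd.
Qed.

Lemma continuous_on_open {T U : UniformSpace} (D : T -> Prop) (f : T -> U) (x : T) :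
  open D -> continuous_on D f -> D x -> continuous f x.
Proof.
  intros hD hf hx; apply (continuous_continuous_on D); [exact (hD x hx) | exact hf].
Qed.

Lemma continuous_pair {T U V : UniformSpace} (f : T -> U) (g : T -> V) (x : T) :
  continuous f x -> continuous g x -> continuous (fun t => (f t, g t)) x.
Proof.
  intros hf hg; apply (continuous_comp_2 f g pair); auto.
  apply (continuous_ext (fun z => z)); [now intros []|apply continuous_id].
Qed.

Lemma continuous_slice (A : R * R * R -> Prop) (c : fun3) (x : R * R) (s : R) :
  open A -> C0_3 A c -> A (x, s) -> continuous (fun t => c (x, t)) s.
Proof.
  intros hA hc h.
  apply (continuous_comp (fun t : R => (x, t)) c).
  - apply (continuous_pair (fun _ => x) (fun t => t));
      [apply continuous_const | apply continuous_id].
  - exact (continuous_on_open A c (x, s) hA hc h).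
Qed.

(** Away from [0] one divides; at [0] the value of [F] is its limit along
    points where division is possible. *)
Lemma continuous_cancel_id (Omega : R -> Prop) (F : R -> R) :
  open Omega -> (forall s, Omega s -> continuous F s) ->
  (forall s, Omega s -> F s * s = 0) ->
  forall s, Omega s -> F s = 0.
Proof.
  intros hO hF h s hs.
  destruct (Req_dec s 0) as [->|hs0].
  2: { destruct (Rmult_integral _ _ (h s hs)); [assumption|contradiction]. }
  assert (lim0 : is_lim F 0 0).
  { apply (is_lim_ext_loc (fun _ => 0)); [|apply is_lim_const].
    destruct (hO 0 hs) as [eps heps].
    exists eps; intros y hy hy0.
    destruct (Rmult_integral _ _ (h y (heps y hy))); [now symmetry|contradiction]. }
  assert (limF : is_lim F 0 (F 0)).
  { apply is_lim_continuity, continuity_pt_filterlim, hF, hs. }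
  apply is_lim_unique in lim0; apply is_lim_unique in limF.
  rewrite lim0 in limF; injection limF; auto.
Qed.

(** * The chain rule for coefficients evaluated at [u] *)

(** One partial derivative that is continuous at the point, together with
    the other one existing there, makes [F] differentiable; this is what allows
    the two increments along the graph of [v] to be added. *)
Lemma is_derive_comp_graph (F F1 : R -> R -> R) (Fs : R) (v : R -> R) (t0 dv : R) :
  locally (t0, v t0) (fun z => is_derive (fun t => F t (snd z)) (fst z)
                                         (F1 (fst z) (snd z))) ->
  is_derive (fun s => F t0 s) (v t0) Fs ->
  continuous (fun z => F1 (fst z) (snd z)) (t0, v t0) ->
  is_derive v t0 dv ->
  is_derive (fun t => F t (v t)) t0 (F1 t0 (v t0) + Fs * dv).
Proof.
  intros h1 hs hc hv.
  apply is_derive_Reals.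
  replace (F1 t0 (v t0) + Fs * dv) with (F1 t0 (v t0) * 1 + Fs * dv) by ring.
  apply (derivable_pt_lim_comp_2d F (fun t => t) v).
  - apply filterdiff_differentiable_pt_lim.
    exact (is_derive_filterdiff F t0 (v t0) F1 Fs h1 hs hc).
  - apply derivable_pt_lim_id.
  - now apply is_derive_Reals.
Qed.

Lemma is_derive_coef_x1 (A : R * R * R -> Prop) (c : fun3) (u : fun2) (x : R * R) :
  open A -> C1_3 A c -> A (x, u x) -> ex_Dx1 u x ->
  is_derive (fun t => c ((t, snd x), u (t, snd x))) (fst x)
    (D3x1 c (x, u x) + D3u c (x, u x) * Dx1 u x).
Proof.
  intros hA (_ & hex & h1 & _ & _) hp hu; destruct x as [x1 x2].
  assert (hphi : continuous (fun z : R * R => ((fst z, x2), snd z)) (x1, u (x1, x2))).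
  { apply (continuous_pair (fun z : R * R => (fst z, x2)) snd); [|apply continuous_snd].
    apply (continuous_pair fst (fun _ => x2)); [apply continuous_fst|apply continuous_const]. }
  apply (is_derive_comp_graph (fun t s => c ((t, x2), s))
           (fun t s => D3x1 c ((t, x2), s)) _ (fun t => u (t, x2))).
  - generalize (hphi _ (hA _ hp)); unfold filtermap.
    apply filter_imp; intros z hz.
    exact (Derive_correct _ _ (proj1 (hex _ hz))).
  - exact (Derive_correct _ _ (proj2 (proj2 (hex _ hp)))).
  - exact (continuous_comp _ (D3x1 c) _ hphi (continuous_on_open A _ _ hA h1 hp)).
  - exact (Derive_correct _ _ hu).
Qed.

Lemma is_derive_coef_x2 (A : R * R * R -> Prop) (c : fun3) (u : fun2) (x : R * R) :
  open A -> C1_3 A c -> A (x, u x) -> ex_Dx2 u x ->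
  is_derive (fun t => c ((fst x, t), u (fst x, t))) (snd x)
    (D3x2 c (x, u x) + D3u c (x, u x) * Dx2 u x).
Proof.
  intros hA (_ & hex & _ & h2 & _) hp hu; destruct x as [x1 x2].
  assert (hphi : continuous (fun z : R * R => ((x1, fst z), snd z)) (x2, u (x1, x2))).
  { apply (continuous_pair (fun z : R * R => (x1, fst z)) snd); [|apply continuous_snd].
    apply (continuous_pair (fun _ => x1) fst); [apply continuous_const|apply continuous_fst]. }
  apply (is_derive_comp_graph (fun t s => c ((x1, t), s))
           (fun t s => D3x2 c ((x1, t), s)) _ (fun t => u (x1, t))).
  - generalize (hphi _ (hA _ hp)); unfold filtermap.
    apply filter_imp; intros z hz.
    exact (Derive_correct _ _ (proj1 (proj2 (hex _ hz)))).
  - exact (Derive_correct _ _ (proj2 (proj2 (hex _ hp)))).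
  - exact (continuous_comp _ (D3x2 c) _ hphi (continuous_on_open A _ _ hA h2 hp)).
  - exact (Derive_correct _ _ hu).
Qed.

(** * Expansion of the product of two brackets *)

Lemma op1_expand (c : nat -> nat -> fun3) (u v : fun2) (x : R * R) :
  op 1 c u v x = c 0%nat 1%nat (x, u x) * v x
    + c 1%nat 1%nat (x, u x) * Dx1 v x + c 1%nat 2%nat (x, u x) * Dx2 v x.
Proof.
  unfold op, sum_n_m; simpl; unfold plus, zero; cbn; ring.
Qed.

Lemma op2_expand (c : nat -> nat -> fun3) (u v : fun2) (x : R * R) :
  op 2 c u v x = c 0%nat 1%nat (x, u x) * v x
    + c 1%nat 1%nat (x, u x) * Dx1 v x + c 1%nat 2%nat (x, u x) * Dx2 v x
    + c 2%nat 1%nat (x, u x) * Dx1 (Dx1 v) x + c 2%nat 2%nat (x, u x) * Dx2 (Dx1 v) x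
    + c 2%nat 3%nat (x, u x) * Dx1 (Dx2 v) x + c 2%nat 4%nat (x, u x) * Dx2 (Dx2 v) x.
Proof.
  unfold op, sum_n_m; simpl; unfold plus, zero; cbn; ring.
Qed.

Lemma is_derive_sum3_mult (f1 f2 f3 g1 g2 g3 : R -> R) (t a1 a2 a3 d1 d2 d3 : R) :
  is_derive f1 t a1 -> is_derive f2 t a2 -> is_derive f3 t a3 ->
  is_derive g1 t d1 -> is_derive g2 t d2 -> is_derive g3 t d3 ->
  is_derive (fun t => f1 t * g1 t + f2 t * g2 t + f3 t * g3 t) t
    (a1 * g1 t + f1 t * d1 + (a2 * g2 t + f2 t * d2) + (a3 * g3 t + f3 t * d3)).
Proof.
  intros hf1 hf2 hf3 hg1 hg2 hg3.
  assert (hmul : forall (f g : R -> R) a d, is_derive f t a -> is_derive g t d ->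
            is_derive (fun r => f r * g r) t (a * g t + f t * d)).
  { intros f g a d hf hg; exact (is_derive_mult f g t a d hf hg Rmult_comm). }
  apply (is_derive_plus (fun r => f1 r * g1 r + f2 r * g2 r) (fun r => f3 r * g3 r));
    [apply (is_derive_plus (fun r => f1 r * g1 r) (fun r => f2 r * g2 r))|]; auto.
Qed.

Section Bracket.

Variables (A : R * R * R -> Prop) (c : nat -> nat -> fun3) (u : fun2) (x : R * R).
Hypotheses (hA : open A) (hc : forall k h, index 1 k h -> C1_3 A (c k h)).
Hypothesis hp : A (x, u x).

Let hc01 : C1_3 A (c 0%nat 1%nat).
Proof. apply hc; split; simpl; lia. Qed.
Let hc11 : C1_3 A (c 1%nat 1%nat).
Proof. apply hc; split; simpl; lia. Qed.
Let hc12 : C1_3 A (c 1%nat 2%nat).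
Proof. apply hc; split; simpl; lia. Qed.

Lemma Dx1_bracket :
  ex_Dx1 u x -> ex_Dx1 (Dx1 u) x -> ex_Dx1 (Dx2 u) x ->
  let d f := D3x1 f (x, u x) + D3u f (x, u x) * Dx1 u x in
  Dx1 (op 1 c u u) x =
    d (c 0%nat 1%nat) * u x + c 0%nat 1%nat (x, u x) * Dx1 u x
    + (d (c 1%nat 1%nat) * Dx1 u x + c 1%nat 1%nat (x, u x) * Dx1 (Dx1 u) x)
    + (d (c 1%nat 2%nat) * Dx2 u x + c 1%nat 2%nat (x, u x) * Dx1 (Dx2 u) x).
Proof.
  intros hu hu1 hu2 d; unfold Dx1 at 1.
  rewrite (Derive_ext _ _ _ (fun t => op1_expand c u u (t, snd x))).
  apply is_derive_unique.
  pose proof (is_derive_sum3_mult _ _ _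
    (fun t => u (t, snd x)) (fun t => Dx1 u (t, snd x)) (fun t => Dx2 u (t, snd x))
    _ _ _ _ _ _ _
    (is_derive_coef_x1 A _ u x hA hc01 hp hu) (is_derive_coef_x1 A _ u x hA hc11 hp hu)
    (is_derive_coef_x1 A _ u x hA hc12 hp hu)
    (Derive_correct _ _ hu) (Derive_correct _ _ hu1) (Derive_correct _ _ hu2)) as H.
  destruct x as [x1 x2]; exact H.
Qed.

Lemma Dx2_bracket :
  ex_Dx2 u x -> ex_Dx2 (Dx1 u) x -> ex_Dx2 (Dx2 u) x ->
  let d f := D3x2 f (x, u x) + D3u f (x, u x) * Dx2 u x in
  Dx2 (op 1 c u u) x =
    d (c 0%nat 1%nat) * u x + c 0%nat 1%nat (x, u x) * Dx2 u x
    + (d (c 1%nat 1%nat) * Dx1 u x + c 1%nat 1%nat (x, u x) * Dx2 (Dx1 u) x)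
    + (d (c 1%nat 2%nat) * Dx2 u x + c 1%nat 2%nat (x, u x) * Dx2 (Dx2 u) x).
Proof.
  intros hu hu1 hu2 d; unfold Dx2 at 1.
  rewrite (Derive_ext _ _ _ (fun t => op1_expand c u u (fst x, t))).
  apply is_derive_unique.
  pose proof (is_derive_sum3_mult _ _ _
    (fun t => u (fst x, t)) (fun t => Dx1 u (fst x, t)) (fun t => Dx2 u (fst x, t))
    _ _ _ _ _ _ _
    (is_derive_coef_x2 A _ u x hA hc01 hp hu) (is_derive_coef_x2 A _ u x hA hc11 hp hu)
    (is_derive_coef_x2 A _ u x hA hc12 hp hu)
    (Derive_correct _ _ hu) (Derive_correct _ _ hu1) (Derive_correct _ _ hu2)) as H.
  destruct x as [x1 x2]; exact H.
Qed.

End Bracket.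

(** The product as a polynomial in the jet of [u], grouped by monomials, so
    that each condition of the theorem can be read off one coefficient. *)
Lemma bracket_product (A : R * R * R -> Prop) (b : nat -> nat -> nat -> fun3)
    (D : R * R -> Prop) (u : fun2) (x : R * R) :
  open A -> (forall k h, index 1 k h -> C1_3 A (b 2%nat k h)) ->
  Cn2 2 D u -> D x -> A (x, u x) ->
  let p := (x, u x) in
  let b101 := b 1%nat 0%nat 1%nat in
  let b111 := b 1%nat 1%nat 1%nat in
  let b112 := b 1%nat 1%nat 2%nat in
  let b201 := b 2%nat 0%nat 1%nat in
  let b211 := b 2%nat 1%nat 1%nat in
  let b212 := b 2%nat 1%nat 2%nat in
  op 1 (b 1%nat) u (op 1 (b 2%nat) u u) x =
    (b101 p * b201 p + Lop b b201 p) * u x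
    + (b101 p * b211 p + b111 p * b201 p + Lop b b211 p + b111 p * D3u b201 p * u x)
      * Dx1 u x
    + (b101 p * b212 p + b112 p * b201 p + Lop b b212 p + b112 p * D3u b201 p * u x)
      * Dx2 u x
    + b111 p * D3u b211 p * (Dx1 u x * Dx1 u x)
    + (b111 p * D3u b212 p + b112 p * D3u b211 p) * (Dx1 u x * Dx2 u x)
    + b112 p * D3u b212 p * (Dx2 u x * Dx2 u x)
    + b111 p * b211 p * Dx1 (Dx1 u) x
    + b112 p * b211 p * Dx2 (Dx1 u) x
    + b111 p * b212 p * Dx1 (Dx2 u) x
    + b112 p * b212 p * Dx2 (Dx2 u) x.
Proof.
  intros hA hb hu hx hp; cbv zeta.
  destruct hu as (_ & hex & (_ & hex1 & _) & (_ & hex2 & _)).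
  destruct (hex x hx), (hex1 x hx), (hex2 x hx).
  rewrite op1_expand, (Dx1_bracket A), (Dx2_bracket A) by assumption.
  rewrite op1_expand; unfold Lop; ring.
Qed.

Lemma Schwarz_C2 (D : R * R -> Prop) (u : fun2) (x : R * R) :
  open D -> Cn2 2 D u -> D x -> Dx2 (Dx1 u) x = Dx1 (Dx2 u) x.
Proof.
  intros hD hu hx; destruct x as [x1 x2].
  destruct hu as (_ & hex & (_ & hex1 & _ & (h12 & _)) & (_ & hex2 & (h21 & _) & _)).
  symmetry; apply (Schwarz (fun a d => u (a, d)) x1 x2).
  - apply locally_2d_locally; generalize (hD _ hx).
    apply filter_imp; intros z hz; destruct z as [z1 z2].
    destruct (hex _ hz), (hex1 _ hz), (hex2 _ hz); repeat split; assumption.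
  - apply continuity_2d_pt_filterlim.
    apply (continuous_ext (Dx1 (Dx2 u))); [now intros []|].
    exact (continuous_on_open D _ _ hD h21 hx).
  - apply continuity_2d_pt_filterlim.
    apply (continuous_ext (Dx2 (Dx1 u))); [now intros []|].
    exact (continuous_on_open D _ _ hD h12 hx).
Qed.

(** * Quadratic polynomials with a prescribed jet *)

(** The polynomial whose jet at [x] is
    [u = s], [u_1 = a1], [u_2 = a2], [u_11 = a11], [u_12 = a12], [u_22 = a22]. *)
Definition quad (x : R * R) (s a1 a2 a11 a12 a22 : R) : fun2 :=
  fun y =>
    let h1 := fst y - fst x in
    let h2 := snd y - snd x in
    s + a1 * h1 + a2 * h2 + a11 / 2 * (h1 * h1) + a12 * (h1 * h2) + a22 / 2 * (h2 * h2).

(** This family of polynomials is stable under both partial derivatives, which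
    is why the smoothness proof below is a plain induction. *)
Lemma Dx1_quad (x : R * R) (s a1 a2 a11 a12 a22 : R) :
  Dx1 (quad x s a1 a2 a11 a12 a22) = quad x a1 a11 a12 0 0 0.
Proof.
  apply functional_extensionality; intros y; unfold Dx1, quad; simpl.
  apply is_derive_unique; auto_derive; [exact I|field].
Qed.

Lemma Dx2_quad (x : R * R) (s a1 a2 a11 a12 a22 : R) :
  Dx2 (quad x s a1 a2 a11 a12 a22) = quad x a2 a12 a22 0 0 0.
Proof.
  apply functional_extensionality; intros y; unfold Dx2, quad; simpl.
  apply is_derive_unique; auto_derive; [exact I|field].
Qed.

Lemma quad_center (x : R * R) (s a1 a2 a11 a12 a22 : R) :
  quad x s a1 a2 a11 a12 a22 x = s.
Proof. unfold quad; cbv zeta; field. Qed.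

Lemma continuous_quad (x : R * R) (s a1 a2 a11 a12 a22 : R) (y : R * R) :
  continuous (quad x s a1 a2 a11 a12 a22) y.
Proof.
  assert (h1 : continuous (fun z : R * R => fst z - fst x) y).
  { apply (continuous_minus (fun z : R * R => fst z) (fun _ => fst x));
      [destruct y; apply continuous_fst | apply continuous_const]. }
  assert (h2 : continuous (fun z : R * R => snd z - snd x) y).
  { apply (continuous_minus (fun z : R * R => snd z) (fun _ => snd x));
      [destruct y; apply continuous_snd | apply continuous_const]. }
  assert (hscal : forall (k : R) (f : R * R -> R),
            continuous f y -> continuous (fun z => k * f z) y).
  { intros k f hf; apply (continuous_mult (fun _ => k) f);
      [apply continuous_const | exact hf]. }
  assert (hmult : forall f f' : R * R -> R,
            continuous f y -> continuous f' y -> continuous (fun z => f z * f' z) y).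
  { intros f f'; apply (continuous_mult f f'). }
  assert (hplus : forall f f' : R * R -> R,
            continuous f y -> continuous f' y -> continuous (fun z => f z + f' z) y).
  { intros f f'; apply (continuous_plus f f'). }
  unfold quad; cbv zeta.
  repeat apply hplus; try apply hscal; try apply hmult; try assumption.
  apply continuous_const.
Qed.

Lemma Cn2_quad (n : nat) (D : R * R -> Prop) (x : R * R) (s a1 a2 a11 a12 a22 : R) :
  Cn2 n D (quad x s a1 a2 a11 a12 a22).
Proof.
  revert s a1 a2 a11 a12 a22; induction n as [|n IH]; intros s a1 a2 a11 a12 a22;
    (split; [apply continuous_on_forall; intros; apply continuous_quad|]).
  - exact I.
  - rewrite Dx1_quad, Dx2_quad; split; [|split; apply IH].
    intros y _; unfold ex_Dx1, ex_Dx2, quad; simpl; split; auto_derive; exact I.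
Qed.

(** * The decomposition criterion *)

(** Shrinking the domain to the open set where the polynomial takes values in
    [Omega] makes every symmetric 2-jet with value in [Omega] admissible. *)
Lemma decomposes_on_jets (Lambda : R * R -> Prop) (Omega : R -> Prop)
    (g : nat -> nat -> fun3) (b : nat -> nat -> nat -> fun3) :
  open Lambda -> open Omega -> decomposes Lambda Omega g b ->
  forall x s a1 a2 a11 a12 a22, Lambda x -> Omega s ->
  let u := quad x s a1 a2 a11 a12 a22 in
  op 2 g u u x = op 1 (b 1%nat) u (op 1 (b 2%nat) u u) x.
Proof.
  intros hL hO hdec x s a1 a2 a11 a12 a22 hx hs u.
  apply (hdec (fun y => Lambda y /\ Omega (u y))).
  - apply open_and; [exact hL|].
    apply (open_comp u Omega); [intros y _; apply continuous_quad | exact hO].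
  - intros y hy; apply hy.
  - split; [apply Cn2_quad|intros y hy; apply hy].
  - split; [exact hx|]; unfold u; rewrite quad_center; exact hs.
Qed.

Theorem proposition3p2
  (Lambda : R * R -> Prop) (Omega : R -> Prop)
  (g : nat -> nat -> fun3) (b : nat -> nat -> nat -> fun3)
  (hLambda : open Lambda) (hOmega : open Omega)
  (hg : forall k h : nat, index 2 k h -> C0_3 (setprod Lambda Omega) (g k h))
  (hb1 : forall k h : nat, index 1 k h -> C0_3 (setprod Lambda Omega) (b 1%nat k h))
  (hb2 : forall k h : nat, index 1 k h -> C1_3 (setprod Lambda Omega) (b 2%nat k h)) :
  let g01 := g 0%nat 1%nat in
  let g11 := g 1%nat 1%nat in
  let g12 := g 1%nat 2%nat in
  let g21 := g 2%nat 1%nat in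
  let g22 := g 2%nat 2%nat in
  let g23 := g 2%nat 3%nat in
  let g24 := g 2%nat 4%nat in
  let b101 := b 1%nat 0%nat 1%nat in
  let b111 := b 1%nat 1%nat 1%nat in
  let b112 := b 1%nat 1%nat 2%nat in
  let b201 := b 2%nat 0%nat 1%nat in
  let b211 := b 2%nat 1%nat 1%nat in
  let b212 := b 2%nat 1%nat 2%nat in
  decomposes Lambda Omega g b <->
  (forall (x : R * R) (s : R), Lambda x -> Omega s ->
     let p := (x, s) in
     g21 p = b111 p * b211 p /\
     g22 p + g23 p = b112 p * b211 p + b111 p * b212 p /\
     g24 p = b112 p * b212 p /\
     g11 p = b101 p * b211 p + b111 p * b201 p + Lop b b211 p + b111 p * D3u b201 p * s /\
     g12 p = b101 p * b212 p + b112 p * b201 p + Lop b b212 p + b112 p * D3u b201 p * s /\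
     g01 p = b101 p * b201 p + Lop b b201 p /\
     0 = b112 p * D3u b212 p /\
     0 = b111 p * D3u b211 p /\
     0 = b111 p * D3u b212 p + b112 p * D3u b211 p).
Proof.
  intros g01 g11 g12 g21 g22 g23 g24 b101 b111 b112 b201 b211 b212.
  pose proof (open_setprod _ _ hLambda hOmega) as hA.
  split.
  - intros hdec.
    assert (key : forall x s, Lambda x -> Omega s -> forall a1 a2 a11 a12 a22,
      let p := (x, s) in
      g01 p * s + g11 p * a1 + g12 p * a2
      + g21 p * a11 + (g22 p + g23 p) * a12 + g24 p * a22 =
      (b101 p * b201 p + Lop b b201 p) * s
      + (b101 p * b211 p + b111 p * b201 p + Lop b b211 p + b111 p * D3u b201 p * s) * a1
      + (b101 p * b212 p + b112 p * b201 p + Lop b b212 p + b112 p * D3u b201 p * s) * a2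
      + b111 p * D3u b211 p * (a1 * a1)
      + (b111 p * D3u b212 p + b112 p * D3u b211 p) * (a1 * a2)
      + b112 p * D3u b212 p * (a2 * a2)
      + b111 p * b211 p * a11 + (b112 p * b211 p + b111 p * b212 p) * a12
      + b112 p * b212 p * a22).
    { intros x s hx hs a1 a2 a11 a12 a22 p.
      pose proof (decomposes_on_jets _ _ _ _ hLambda hOmega hdec
                    x s a1 a2 a11 a12 a22 hx hs) as H; cbv zeta in H.
      rewrite op2_expand in H.
      rewrite (bracket_product (setprod Lambda Omega) b Lambda) in H;
        [|exact hA|exact hb2|apply Cn2_quad|exact hx
         |split; [exact hx|rewrite quad_center; exact hs]].
      rewrite !Dx1_quad, !Dx2_quad, ?Dx1_quad, ?Dx2_quad, !quad_center in H.
      fold p g01 g11 g12 g21 g22 g23 g24 b101 b111 b112 b201 b211 b212 in H.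
      lra. }
    intros x s hx hs p.
    assert (h01 : g01 p = b101 p * b201 p + Lop b b201 p).
    { apply Rminus_diag_uniq.
      apply (continuous_cancel_id Omega
        (fun t => g01 (x, t) - (b101 (x, t) * b201 (x, t) + Lop b b201 (x, t))));
        [exact hOmega| |intros t ht|exact hs].
      2: { pose proof (key x t hx ht 0 0 0 0 0) as H; cbv zeta in H; lra. }
      intros t ht.
      assert (hslice : forall c, C0_3 (setprod Lambda Omega) c ->
                continuous (fun r => c (x, r)) t).
      { intros c hc; apply (continuous_slice (setprod Lambda Omega)); auto.
        split; assumption. }
      assert (hmult : forall f f' : R -> R,
                continuous f t -> continuous f' t -> continuous (fun r => f r * f' r) t).
      { intros f f'; apply (continuous_mult f f'). }
      assert (hplus : forall f f' : R -> R,
                continuous f t -> continuous f' t -> continuous (fun r => f r + f' r) t).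
      { intros f f'; apply (continuous_plus f f'). }
      assert (h201 : C1_3 (setprod Lambda Omega) b201).
      { apply hb2; split; simpl; lia. }
      destruct h201 as (h0 & _ & h1 & h2 & _).
      apply (continuous_minus (fun r => g01 (x, r))
        (fun r => b101 (x, r) * b201 (x, r) + Lop b b201 (x, r))).
      - apply hslice, hg; split; simpl; lia.
      - unfold Lop; repeat apply hplus; apply hmult; apply hslice; try assumption;
          apply hb1; split; simpl; lia. }
    (* The 2-jets below isolate the monomials: [-1] next to [1] separates the
       linear from the quadratic part, and [(1, 1)] reaches the mixed term. *)
    specialize (key x s hx hs).
    pose proof (key 0 0 1 0 0) as k11; pose proof (key 0 0 0 1 0) as k12.
    pose proof (key 0 0 0 0 1) as k22.
    pose proof (key 1 0 0 0 0) as k1; pose proof (key (-1) 0 0 0 0) as k1'.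
    pose proof (key 0 1 0 0 0) as k2; pose proof (key 0 (-1) 0 0 0) as k2'.
    pose proof (key 1 1 0 0 0) as kmix.
    clear key; cbv zeta in *; fold p in k11, k12, k22, k1, k1', k2, k2', kmix.
    rewrite h01 in *.
    repeat split; lra.
  - intros hcond D hD hDL u [hu huO] x hx.
    destruct (hcond x (u x) (hDL x hx) (huO x hx))
      as (e21 & e22 & e24 & e11 & e12 & e01 & q22 & q11 & q12).
    rewrite op2_expand, (bracket_product (setprod Lambda Omega) b D);
      [|exact hA|exact hb2|exact hu|exact hx|exact (conj (hDL x hx) (huO x hx))].
    rewrite (Schwarz_C2 D u x hD hu hx).
    fold g01 g11 g12 g21 g22 g23 g24 b101 b111 b112 b201 b211 b212.
    rewrite <- q11, <- q12, <- q22, <- e01, <- e11, <- e12, <- e21, <- e24.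
    assert (e23 : g23 (x, u x) = b112 (x, u x) * b211 (x, u x)
                    + b111 (x, u x) * b212 (x, u x) - g22 (x, u x)) by lra.
    rewrite e23; ring.
Qed.
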